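(* Let $s,t\in\mathbb{C}$ with $t\neq 0$ and $0<|q|<1$, where $q=\varphi_{s,t}'/\varphi_{s,t}$, and let $u\in\mathbb{C}$. Then, as formal power series in $x$ (hence also as an identity of sums for every $x\in\mathbb{C}$ for which the series converge), $$\sum_{n=0}^{\infty}\genfrac{[}{]}{0pt}{}{2n}{n}_{q}\frac{(-u/t)^{\binom{n}{2}}}{(-\sqrt{q};q)_{n}(-q;q)_{n}}\left(\frac{4x}{\sqrt{-t\varphi_{s,t}}}\right)^n={}_{1}\Phi_{0}\left(\begin{array}{c} \sqrt{q} \\ - \end{array};q,-\frac{u}{t},\frac{4x}{\sqrt{-t\varphi_{s,t}}}\right).$$
   Context: $\varphi_{s,t}=\frac{s+\sqrt{s^2+4t}}{2}$ and $\varphi_{s,t}'=\frac{s-\sqrt{s^2+4t}}{2}$ (for a fixed choice of the square root), so that $\varphi_{s,t}\varphi_{s,t}'=-t$; $q=\varphi_{s,t}'/\varphi_{s,t}$. Square roots $\sqrt q$ and $\sqrt{-t\varphi_{s,t}}$ are fixed once and for all. $(a;q)_0=1$ and $(a;q)_n=\prod_{k=0}^{n-1}(1-aq^k)$ for $n\ge1$; $(a_1,\dots,a_m;q)_n=(a_1;q)_n\cdots(a_m;q)_n$. The $q$-binomial coefficient is $\genfrac{[}{]}{0pt}{}{n}{k}_{q}=\frac{(q;q)_n}{(q;q)_k(q;q)_{n-k}}$. The deformed basic hypergeometric series is ${}_{r}\Phi_{r'}\left(\begin{array}{c} a_1,\ldots,a_r \\ b_1,\ldots,b_{r'} \end{array};q,v,z\right)=\sum_{n\ge0}v^{\binom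 n2}\frac{(a_1,\ldots,a_r;q)_n}{(q,b_1,\ldots,b_{r'};q)_n}\bigl[(-1)^nq^{\binom n2}\bigr]^{1+r'-r}z^n$; in particular ${}_{1}\Phi_{0}\left(\begin{array}{c} a \\ - \end{array};q,v,z\right)=\sum_{n\ge0}v^{\binom n2}\frac{(a;q)_n}{(q;q)_n}z^n$. Convention: $0^0=1$. *)

(* Defs.v *)
From HB Require Import structures.
From mathcomp Require Import all_boot all_order all_algebra.
From mathcomp Require Import all_classical all_reals all_analysis.
From mathcomp Require Import complex.

Set Implicit Arguments.
Unset Strict Implicit.
Unset Printing Implicit Defensive.

Import Order.TTheory GRing.Theory Num.Theory.
Import numFieldNormedType.Exports.

Local Open Scope classical_set_scope.
Local Open Scope ring_scope.

(* The roots of X^2 - s X - t; [delta] is the chosen square root of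
   s^2 + 4 t. *)
Definition phi (K : fieldType) (s delta : K) : K := (s + delta) / 2.
Definition phi' (K : fieldType) (s delta : K) : K := (s - delta) / 2.

Definition qpoch (K : fieldType) (a q : K) (n : nat) : K :=
  \prod_(k < n) (1 - a * q ^+ k).

Definition qpochs (K : fieldType) (aa : seq K) (q : K) (n : nat) : K :=
  \prod_(a <- aa) qpoch a q n.

(* Meaningful for k <= n only, because n - k is truncated. *)
Definition qbinom (K : fieldType) (q : K) (n k : nat) : K :=
  qpoch q q n / (qpoch q q k * qpoch q q (n - k)).

(* A formal power series is its sequence of coefficients. *)
Definition fps (K : fieldType) := nat -> K.

(* The series f(c x) in the indeterminate x. *)
Definition fps_dilate (K : fieldType) (c : K) (f : fps K) : fps K :=
  fun n => f n * c ^+ n.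

Definition fps_sums_to (K : numFieldType) (f : fps K) (z l : K) : Prop :=
  series (fun n => f n * z ^+ n) @ \oo --> l.

(* The deformed basic hypergeometric series, as a formal power series in its
   last argument z.  The exponent 1 + r' - r is an integer and may be
   negative. *)
Definition Phi (K : fieldType) (aa bb : seq K) (q v : K) : fps K :=
  fun n =>
    v ^+ 'C(n, 2) * (qpochs aa q n / qpochs (q :: bb) q n) *
    ((-1) ^+ n * q ^+ 'C(n, 2)) ^ (1 + (size bb)%:Z - (size aa)%:Z).

(* Main.v *)
Require Import Defs.
From HB Require Import structures.
From mathcomp Require Import all_boot all_order all_algebra.
From mathcomp Require Import all_classical all_reals all_analysis.
From mathcomp Require Import complex ring.

(** The two series agree coefficient by coefficient; the claim about sums is
    then immediate.

    Write q = r^2.  In (q; q)_2n = prod_(1 <= j <= 2n) (1 - q^j) the exponents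
    j = 2k + 1 and j = 2k + 2 give differences of squares,
      1 - q^(2k+1) = (1 - r q^k) (1 + r q^k)   and
      1 - q^(2k+2) = (1 - q q^k) (1 + q q^k),
    whence (q; q)_2n = (r; q)_n (-r; q)_n (q; q)_n (-q; q)_n
    ([qpoch_double]).  Dividing by (q; q)_n^2 (-r; q)_n (-q; q)_n leaves
    (r; q)_n / (q; q)_n, the coefficient of 1Phi0.  The divisions are legitimate
    because |q| < 1 and |r| < 1 keep every factor 1 - a q^k away from zero
    ([qpoch_neq0]). *)

Import Order.TTheory GRing.Theory Num.Theory.
Import numFieldNormedType.Exports.

Local Open Scope ring_scope.
Local Open Scope complex_scope.

Lemma qpochS (K : fieldType) (a q : K) (n : nat) :
  qpoch a q n.+1 = qpoch a q n * (1 - a * q ^+ n).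
Proof. by rewrite /qpoch big_ord_recr. Qed.

(** Passing from n to n + 1 adds the two factors 1 - q^(2n+1) and 1 - q^(2n+2)
    on the left; each is a difference of squares because q = r^2. *)
Lemma qpoch_double (K : fieldType) (r : K) (n : nat) (q := r ^+ 2) :
  qpoch q q (2 * n) =
  qpoch r q n * qpoch (- r) q n * (qpoch q q n * qpoch (- q) q n).
Proof.
elim: n => [|n IHn]; first by rewrite muln0 /qpoch !big_ord0 !mulr1.
rewrite mulnS !qpochS IHn exprS mulnC exprM /q.
by ring.
Qed.

(** A factor 1 - a q^k cannot vanish since |a q^k| <= |a| < 1. *)
Lemma qpoch_neq0 (K : numFieldType) (a q : K) (n : nat) :
  `|a| < 1 -> `|q| < 1 -> qpoch a q n != 0.
Proof.
move=> a_lt1 q_lt1; apply/prodf_neq0 => k _.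
rewrite subr_eq0 eq_sym; apply/eqP => aqk1.
suff : `|a * q ^+ k| < 1 by rewrite aqk1 normr1 ltxx.
rewrite normrM normrX; apply: le_lt_trans a_lt1.
by rewrite ler_piMr // exprn_ile1 // ltW.
Qed.

(** From |q| < 1 alone one gets |r| < 1, as |r|^2 = |q|; this is what allows
    (-r; q)_n to be cancelled. *)
Lemma central_qbinom_div (K : numFieldType) (r : K) (n : nat) (q := r ^+ 2) :
  `|q| < 1 ->
  qbinom q (2 * n) n / (qpoch (- r) q n * qpoch (- q) q n) =
  qpoch r q n / qpoch q q n.
Proof.
move=> q_lt1.
have r_lt1 : `|r| < 1 by move: q_lt1; rewrite normrX expr_lt1.
have q0 : qpoch q q n != 0 by exact: qpoch_neq0.
have Nq0 : qpoch (- q) q n != 0 by apply: qpoch_neq0; rewrite ?normrN.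
have Nr0 : qpoch (- r) q n != 0 by apply: qpoch_neq0; rewrite ?normrN.
rewrite /qbinom mul2n -addnn addnK addnn -mul2n qpoch_double.
by field; rewrite q0 Nq0 Nr0.
Qed.

Theorem theorem5 (R : realType) (s t u delta sqrtq w : R[i])
    (hdelta : delta ^+ 2 = s ^+ 2 + 4 * t)
    (q := phi' s delta / phi s delta)
    (hsqrtq : sqrtq ^+ 2 = q)
    (hw : w ^+ 2 = - t * phi s delta)
    (ht : t != 0)
    (hq : 0 < `|q| < 1) :
  let lhs : fps R[i] := fun n =>
    qbinom q (2 * n) n *
    ((- u / t) ^+ 'C(n, 2) / (qpoch (- sqrtq) q n * qpoch (- q) q n)) in
  let rhs : fps R[i] := Phi [:: sqrtq] [::] q (- (u / t)) in
  fps_dilate (4 / w) lhs = fps_dilate (4 / w) rhs /\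
  (forall x l : R[i],
    fps_sums_to lhs (4 * x / w) l <-> fps_sums_to rhs (4 * x / w) l).
Proof.
move=> lhs rhs.
suff -> : lhs = rhs by [].
have [_ q_lt1] := andP hq.
apply: funext => n; rewrite /lhs /rhs /Phi /qpochs !big_cons !big_nil.
(* [mulr1] also erases the sign factor: for 1Phi0 its exponent 1 + r' - r
   computes to 0. *)
rewrite !mulr1 mulNr.
have := @central_qbinom_div _ sqrtq n; rewrite hsqrtq => /(_ q_lt1) <-.
by rewrite mulrCA.
Qed.
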